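(* Let $\mathbf{r}: S^1\to\mathbb{R}^2$ be a $C^\infty$ immersion whose no-silhouette $\mathcal{NS}_{\mathbf{r}}$ is non-empty, and let $\theta_{\mathbf{r}}$ be its aperture angle. Then, for any $\theta\in[0,\theta_{\mathbf{r}})$, there exist a parallel translation $T_\theta:\mathbb{R}^2\to\mathbb{R}^2$ and a continuous function $h_\theta:S^1\to\mathbb{R}_+$ such that $T_\theta(\overline{\mathcal{NS}_{\theta,\mathbf{r}}})$ is the Wulff shape $\mathcal{W}_{h_\theta}$ associated with the support function $h_\theta$.
   Context: Let $\mathbf{r}: S^1\to\mathbb{R}^2$ be a $C^\infty$ immersion. For $s\in S^1$, $d\mathbf{r}_s(T_s(S^1))$ is regarded as a one-dimensional linear subspace of $\mathbb{R}^2$ (identifying $T_{\mathbf{r}(s)}\mathbb{R}^2$ with $\mathbb{R}^2$), so that $\mathbf{r}(s)+d\mathbf{r}_s(T_s(S^1))$ is the affine tangent line at $\mathbf{r}(s)$. For a real number $\theta$, let $R_\theta:\mathbb{R}^2\to\mathbb{R}^2$ be the rotation $R_\theta(x,y)=(x\cos\theta-y\sin\theta,\ x\sin\theta+y\cos\theta)$ and define $$\mathcal{NS}_{\theta,\mathbf{r}}=\mathbb{R}^2-\bigcup_{s\in S^1}\left(\mathbf{r}(s)+R_\theta\left(d\mathbf{r}_s(T_s(S^1))\right)\right).$$ The set $\mathcal{NS}_{\mathbf{r}}=\mathcal{NS}_{0,\mathbf{r}}$ (the complement of the union of all tangent lines) is called the no-silhouette of $\mathbf{r}$; ''$\mathbf{r}$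 has its no-silhouette'' means that it is non-empty. In that case the aperture angle $\theta_{\mathbf{r}}$ ($0<\theta_{\mathbf{r}}\le\frac{\pi}{2}$) is the largest angle such that $\mathcal{NS}_{\theta,\mathbf{r}}\neq\emptyset$ for every $\theta$ with $0\le\theta<\theta_{\mathbf{r}}$. The bar denotes topological closure in $\mathbb{R}^2$. Let $\mathbb{R}_+=\{\lambda\in\mathbb{R}\mid\lambda>0\}$. For a continuous function $h:S^1\to\mathbb{R}_+$ (with $S^1\subset\mathbb{R}^2$ the unit circle), the Wulff shape associated with the support function $h$ is $$\mathcal{W}_h=\bigcap_{s\in S^1}\{P\in\mathbb{R}^2\mid P\cdot s\le h(s)\},$$ where $P\cdot s$ is the standard scalar product. *)

(* Defs.v *)
From HB Require Import structures.
From mathcomp Require Export all_boot all_order all_algebra.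
From mathcomp Require Export all_classical all_reals all_analysis.

Set Implicit Arguments.
Unset Strict Implicit.
Unset Printing Implicit Defensive.

Export Order.TTheory GRing.Theory Num.Theory.
Export numFieldNormedType.Exports.

Local Open Scope classical_set_scope.
Local Open Scope ring_scope.

Section Plane.
Context {R : realType}.
Implicit Types (p q s v : R * R) (r : R * R -> R * R) (theta t : R).

Definition dot p q : R := p.1 * q.1 + p.2 * q.2.

Definition rotation theta p : R * R :=
  (p.1 * cos theta - p.2 * sin theta, p.1 * sin theta + p.2 * cos theta).

Definition unit_circle : set (R * R) := [set s | s.1 ^+ 2 + s.2 ^+ 2 = 1].

(* A map on the circle is a total map on the plane of which only the values on
   [unit_circle] are ever used.  It is studied near [s] in the angular
   coordinate [t |-> rotation t s], which is a local diffeomorphism from the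
   line to the circle sending [0] to [s]. *)
Definition circle_chart r s : R -> R * R := fun t => r (rotation t s).

Definition circle_smooth r : Prop :=
  forall s, unit_circle s ->
  forall (n : nat) t, derivable (derive1n n (circle_chart r s)) t 1.

Definition circle_tangent s : set (R * R) := [set v | dot s v = 0].

(* [rotation (pi / 2) s] is the velocity at [0] of [t |-> rotation t s], a unit
   vector spanning [circle_tangent s]; the scalar product is the coordinate of
   [v] along it. *)
Definition circle_diff r s v : R * R :=
  dot v (rotation (pi / 2) s) *: derive1 (circle_chart r s) 0.

Definition circle_immersion r : Prop :=
  circle_smooth r /\
  forall s, unit_circle s ->
  forall v, circle_tangent s v -> circle_diff r s v = 0 -> v = 0.

Definition rotated_tangent_line theta r s : set (R * R) :=
  [set r s + rotation theta w | w in circle_diff r s @` circle_tangent s].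

Definition NS theta r : set (R * R) :=
  ~` \bigcup_(s in unit_circle) rotated_tangent_line theta r s.

Definition no_silhouette r : set (R * R) := NS 0 r.

Definition aperture_candidates r : set R :=
  [set a | 0 < a <= pi / 2 /\
           forall theta, 0 <= theta < a -> NS theta r !=set0].

(* The supremum is attained, see [aperture_angle_max]. *)
Definition aperture_angle r : R := sup (aperture_candidates r).

Definition translation v : R * R -> R * R := fun p => p + v.

Definition wulff_shape (h : R * R -> R) : set (R * R) :=
  \bigcap_(s in unit_circle) [set p | dot p s <= h s].

Lemma aperture_angle_max r : aperture_candidates r !=set0 ->
  aperture_candidates r (aperture_angle r) /\
  forall a, aperture_candidates r a -> a <= aperture_angle r.
Proof.
move=> ne; have hs : has_sup (aperture_candidates r).
  by split=> //; exists (pi / 2) => a [/andP[]].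
have ub a : aperture_candidates r a -> a <= aperture_angle r.
  by move=> ca; apply: ub_le_sup => //; case: hs.
split=> //; split.
  apply/andP; split.
    by case: ne => a ca; have [/andP[a0 _] _] := ca; exact: lt_le_trans (ub _ ca).
  by apply: ge_sup => // a [/andP[]].
move=> theta /andP[t0 ta].
have [a [_ Pa] ta'] := sup_gt ne ta.
by apply: Pa; rewrite t0.
Qed.

End Plane.

(* Main.v *)
Require Import Defs.
From mathcomp Require Import ring lra.

(** Write [c t = r (cos t, sin t)], a closed regular curve, and let
    [m t = rotation (theta + pi / 2) (c' t)] be the normal of the turned tangent
    line at [c t].  A point [p] lies in the set [NS theta r] when
    [dot (p - c t) (m t)] vanishes for no [t], hence, by connectedness, when it
    keeps one sign.  So [NS theta r] is the union of two intersections of open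
    half-planes, one for each sign.

    Everything else rests on one remark: a linear functional of a closed curve
    has a critical point, so no vector has a positive scalar product with all
    the velocities [c' t], nor with all the normals.

    - If both signs occurred, the difference of a point of each kind would have
      scalar products of one strict sign with all the [m t].  So [NS theta r] is
      a single intersection of open half-planes ([NS_side]).
    - Since [theta] is below the aperture angle, this intersection contains a
      point [v].  Moving a boundary point towards [v] takes it off the boundary
      lines, so the closure is obtained by relaxing the strict inequalities
      ([closure_side]).
    - The closure is bounded ([closed_side_bounded]): an upper bound on the
      derivative of a periodic function bounds its oscillation, so a bound on
      [dot q (c' t)] bounds [dot q] on the chords of [c], and these span the
      plane because a regular closed curve lies on no line.

    Translate [v] to the origin.  The resulting set [K] is bounded and is cut out
    by half-planes whose boundary lines stay away from the origin
    ([side_margin]), so its support function [h] is continuous and positive on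
    the unit circle.  The
    Wulff shape of [h] contains [K] by definition of [h], and is contained in
    each of the half-planes cutting out [K], since [K] already satisfies them
    ([wulff_shape_support]). *)

Set Implicit Arguments.
Unset Strict Implicit.
Unset Printing Implicit Defensive.

Local Open Scope classical_set_scope.
Local Open Scope ring_scope.

(** * The Euclidean plane *)

Section Plane.
Context {R : realType}.
Implicit Types (p q w : R * R) (a b k : R).

Lemma dotC p q : dot p q = dot q p.
Proof. by rewrite /dot; ring. Qed.

Lemma scale_pair k p : k *: p = (k * p.1, k * p.2).
Proof. by []. Qed.

Lemma dotDl p q w : dot (p + q) w = dot p w + dot q w.
Proof. by rewrite /dot /=; ring. Qed.

Lemma dotBl p q w : dot (p - q) w = dot p w - dot q w.
Proof. by rewrite /dot /=; ring. Qed.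

Lemma dotBr p q w : dot p (q - w) = dot p q - dot p w.
Proof. by rewrite /dot /=; ring. Qed.

Lemma dotNr p q : dot p (- q) = - dot p q.
Proof. by rewrite /dot /=; ring. Qed.

Lemma dotZl k p q : dot (k *: p) q = k * dot p q.
Proof. by rewrite scale_pair /dot /=; ring. Qed.

Lemma dotZr k p q : dot p (k *: q) = k * dot p q.
Proof. by rewrite scale_pair /dot /=; ring. Qed.

Lemma dot_eq0 p : dot p p = 0 -> p = 0.
Proof.
case: p => x y; rewrite /dot /= => h.
have x0 : x = 0 by nra.
by have y0 : y = 0 by [nra]; rewrite x0 y0.
Qed.

Lemma dot_rotation a p q : dot p (rotation a q) = dot (rotation (- a) p) q.
Proof. by rewrite /dot /rotation /= cosN sinN; ring. Qed.

Lemma rotationD a b p : rotation (a + b) p = rotation a (rotation b p).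
Proof. by rewrite /rotation /= cosD sinD; congr pair; ring. Qed.

Lemma rotationZ a k p : rotation a (k *: p) = k *: rotation a p.
Proof. by rewrite !scale_pair /rotation /=; congr pair; ring. Qed.

Lemma rotation0 p : rotation 0 p = p.
Proof. by case: p => x y; rewrite /rotation cos0 sin0 /=; congr pair; ring. Qed.

Lemma rotation_pi2 p : rotation (pi / 2) p = (- p.2, p.1).
Proof. by rewrite /rotation cos_pihalf sin_pihalf; congr pair; ring. Qed.

Lemma dot_quarter_turn p : dot p (rotation (pi / 2) p) = 0.
Proof. by rewrite rotation_pi2 /dot /=; ring. Qed.

Lemma rotationN_pi2 p : rotation (- (pi / 2)) p = - rotation (pi / 2) p.
Proof.
by rewrite /rotation cosN sinN cos_pihalf sin_pihalf; congr pair => /=; ring.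
Qed.

Lemma rotationB_pi2 a p : rotation (a - pi / 2) p = - rotation (a + pi / 2) p.
Proof.
rewrite (rotationD a (- (pi / 2))) (rotationD a (pi / 2)) rotationN_pi2.
by rewrite -[in LHS]scaleN1r rotationZ scaleN1r.
Qed.

Lemma dot_rotation2 a p : dot (rotation a p) (rotation a p) = dot p p.
Proof. by rewrite dot_rotation -rotationD addNr rotation0. Qed.

Lemma rotation_eq0 a p : rotation a p = 0 -> p = 0.
Proof. by move=> h; apply: dot_eq0; rewrite -(dot_rotation2 a) h /dot /=; ring. Qed.

Lemma unit_circleE p : unit_circle p <-> dot p p = 1.
Proof. by rewrite /unit_circle /dot /= !expr2. Qed.

Lemma orthogonal_multiple p w : w <> 0 ->
  dot p (rotation (pi / 2) w) = 0 -> p = (dot p w / dot w w) *: w.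
Proof.
case: p w => x y [u v] w0; rewrite rotation_pi2.
have /eqP D : dot (u, v) (u, v) <> 0 by move/dot_eq0.
move: D; rewrite /dot /= => D E.
have E0 : x * v - y * u = 0 by lra.
have Dx : x * (u * u + v * v) = (x * u + y * v) * u.
  by rewrite -[RHS]addr0 -(mulr0 v) -E0; ring.
have Dy : y * (u * u + v * v) = (x * u + y * v) * v.
  by rewrite -[RHS]subr0 -(mulr0 u) -E0; ring.
by rewrite scale_pair /=; congr pair; apply: (mulIf D); [rewrite Dx|rewrite Dy]; field.
Qed.

Lemma rotation_cossin k : rotation k (1, 0) = (cos k, sin k).
Proof. by rewrite /rotation /=; congr pair; ring. Qed.

Lemma rotation_unit_circle a : unit_circle (rotation a (1, 0)).
Proof.
by apply/unit_circleE; rewrite dot_rotation2 /dot /=; ring.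
Qed.

(** Angles may be taken in a compact interval: this is what makes extrema over
    the circle available. *)
Lemma unit_circle_rotation s : unit_circle s ->
  exists2 t : R, t \in `[- pi, pi] & s = rotation t (1, 0).
Proof.
case: s => x y /unit_circleE; rewrite /dot /= => h.
have x1 : -1 <= x <= 1 by apply/andP; split; nra.
have a0 := acos_ge0 x1; have api := acos_lepi x1.
have sE : 1 - x ^+ 2 = y ^+ 2 by rewrite !expr2; lra.
have [y0|y0] := leP 0 y.
  exists (acos x); first by rewrite in_itv/=; lra.
  rewrite /rotation /= sin_acos // acosK ?in_itv// sE sqrtr_sqr ger0_norm //.
  by congr pair; ring.
exists (- acos x); first by rewrite in_itv/=; lra.
rewrite /rotation /= cosN sinN sin_acos // acosK ?in_itv// sE sqrtr_sqr ltr0_norm //.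
by congr pair; ring.
Qed.

Lemma le_norm_fst p : `|p.1| <= `|p|.
Proof. by rewrite prod_normE le_max lexx. Qed.

Lemma le_norm_snd p : `|p.2| <= `|p|.
Proof. by rewrite prod_normE le_max lexx orbT. Qed.

Lemma norm_dot_le p q : `|dot p q| <= 2 * `|p| * `|q|.
Proof.
rewrite /dot (le_trans (ler_normD _ _))// !normrM -mulrA mulr2n mulrDl mul1r.
by rewrite lerD// ler_pM// ?le_norm_fst ?le_norm_snd.
Qed.

Lemma rotation_norm_le a p : `|rotation a p| <= 2 * `|p|.
Proof.
have coord (x y k l : R) : `|x| <= `|p| -> `|y| <= `|p| -> `|k| <= 1 -> `|l| <= 1 ->
    `|x * k + y * l| <= 2 * `|p|.
  move=> xp yp k1 l1; rewrite (le_trans (ler_normD _ _))// !normrM mulr2n mulrDl mul1r.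
  by rewrite lerD// -[leRHS]mulr1 ler_pM.
have cos1 : `|cos a| <= 1 by rewrite ler_norml cos_geN1 cos_le1.
have sin1 : `|sin a| <= 1 by rewrite ler_norml sin_geN1 sin_le1.
rewrite prod_normE ge_max /rotation /=; apply/andP; split.
  by rewrite -mulrN coord ?normrN ?le_norm_fst ?le_norm_snd.
by rewrite coord ?le_norm_fst ?le_norm_snd.
Qed.

(** Cramer's rule recovers [q] from its scalar products with two independent
    vectors. *)
Lemma coordinates_bounded d e M : d.1 * e.2 - d.2 * e.1 <> 0 ->
  exists C : R, forall q, `|dot q d| <= M -> `|dot q e| <= M -> `|q| <= C.
Proof.
set D := _ - _ => /eqP D0.
exists ((M * (`|d| + `|e|)) / `|D|) => q qd qe.
rewrite ler_pdivlMr ?normr_gt0// prod_normE maxr_pMl//.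
have coord (x y u v z : R) : z * D = x * u - y * v -> `|x| <= M -> `|y| <= M ->
    `|u| <= `|e| -> `|v| <= `|d| -> `|z| * `|D| <= M * (`|d| + `|e|).
  move=> zD xM yM ue vd; rewrite -normrM zD (le_trans (ler_normB _ _))// !normrM.
  by rewrite addrC mulrDr lerD// ler_pM.
rewrite ge_max; apply/andP; split.
  apply: (coord (dot q d) (dot q e) e.2 d.2); rewrite ?le_norm_snd//.
  by rewrite /D /dot; ring.
apply: (coord (- dot q d) (- dot q e) e.1 d.1); rewrite ?normrN ?le_norm_fst//.
by rewrite /D /dot; ring.
Qed.

Lemma continuous_fst : continuous (fun p : R * R => p.1).
Proof. by move=> p; exact: cvg_fst. Qed.

Lemma continuous_snd : continuous (fun p : R * R => p.2).
Proof. by move=> p; exact: cvg_snd. Qed.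

Lemma cvg_dot (T : Type) (F : set_system T) {FF : Filter F} (f g : T -> R * R) p q :
  f @ F --> p -> g @ F --> q -> (fun x => dot (f x) (g x)) @ F --> dot p q.
Proof.
have fst_cvg (h : T -> R * R) w : h @ F --> w -> (fun x => (h x).1) @ F --> w.1.
  by move=> hw; apply: cvg_comp hw _; exact: continuous_fst.
have snd_cvg (h : T -> R * R) w : h @ F --> w -> (fun x => (h x).2) @ F --> w.2.
  by move=> hw; apply: cvg_comp hw _; exact: continuous_snd.
move=> fp gq.
exact: cvgD (cvgM (fst_cvg _ _ fp) (fst_cvg _ _ gq))
            (cvgM (snd_cvg _ _ fp) (snd_cvg _ _ gq)).
Qed.

Lemma rotation_continuous a : continuous (@rotation R a).
Proof.
move=> p.
have -> : @rotation R a = (fun q => (dot q (cos a, - sin a), dot q (sin a, cos a))).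
  by apply/funext => q; rewrite /rotation /dot /= mulrN.
have dotl w : dot q w @[q --> p] --> dot p w.
  by apply: cvg_dot; [exact: cvg_id|exact: cvg_cst].
exact: cvg_pair (dotl _) (dotl _).
Qed.

Lemma is_derive_dot (c : R -> R * R) q (t : R) :
  derivable c t 1 -> is_derive t 1 (fun x => dot q (c x)) (dot q (c^`()%classic t)).
Proof.
move=> dc.
have h : (fun h => h^-1 *: (((fun x => dot q (c x)) \o shift t) (h *: 1) - dot q (c t)))
   @ 0^' --> dot q (c^`()%classic t).
  have -> : (fun h => h^-1 *: (((fun x => dot q (c x)) \o shift t) (h *: 1) - dot q (c t)))
     = (fun h => dot q (h^-1 *: ((c \o shift t) (h *: 1) - c t))).
    by apply/funext => h; rewrite dotZr dotBr.
  by apply: cvg_dot; [exact: cvg_cst|rewrite derive1E; exact: dc].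
by apply: DeriveDef; [apply/cvg_ex; exists (dot q (c^`()%classic t))|exact: cvg_lim h].
Qed.

End Plane.

(** * Functions of an angle *)

Section Circular.
Context {R : realType}.
Implicit Types (t s a x : R).

(** Periodicity phrased as factoring through the circle: a value at any angle is
    also a value at an angle in [[- pi, pi]], with no Euclidean division. *)
Definition circular (T : Type) (f : R -> T) : Prop :=
  forall s t, rotation s (1, 0) = rotation t (1, 0) -> f s = f t.

Lemma rotation_period t : rotation (t + pi + pi) (1, 0) = rotation t (1, 0).
Proof. by rewrite !rotation_cossin !cosDpi !sinDpi !opprK. Qed.

Lemma circular_dot (c : R -> R * R) (q : R * R) :
  circular c -> circular (fun t => dot q (c t)).
Proof. by move=> cc s t /cc ->. Qed.

Lemma circular_derive1 (c : R -> R * R) : circular c -> circular c^`()%classic.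
Proof.
move=> cc s t st; rewrite /derive1.
congr (lim (_ @ 0^')); apply/funext => x.
by congr (_ *: (_ - _)); apply: cc => //; rewrite !rotationD st.
Qed.

Lemma circular_reduce (T : Type) (f : R -> T) t : circular f ->
  exists2 t', t' \in `[- pi, pi] & f t' = f t.
Proof.
move=> cf; have [t' ? tt'] := unit_circle_rotation (rotation_unit_circle t).
by exists t' => //; apply: cf.
Qed.

Lemma circular_max (f : R -> R) : continuous f -> circular f ->
  exists t0, forall t, f t <= f t0.
Proof.
move=> /continuous_subspaceT cf per.
have pi0 := pi_gt0 R.
have [t0 _ max] := @EVT_max R f (- pi) pi ltac:(lra) (cf _).
by exists t0 => t; have [t' /max ? <-] := circular_reduce t per.
Qed.

Lemma circular_min (f : R -> R) : continuous f -> circular f ->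
  exists t0, forall t, f t0 <= f t.
Proof.
move=> cf per.
have [|s t /per ->//|t0 h] := @circular_max (fun t => - f t).
  by move=> x; apply: continuousN; exact: cf.
by exists t0 => t; rewrite -lerN2.
Qed.

Lemma is_derive1_continuous (f df : R -> R) :
  (forall t, is_derive t 1 f (df t)) -> continuous f.
Proof.
move=> fdf t; apply/differentiable_continuous/derivable1_diffP.
by have := fdf t; case.
Qed.

(** The mean value theorem over one turn. *)
Lemma circular_critical (f df : R -> R) : circular f ->
  (forall t, is_derive t 1 f (df t)) -> exists t, df t = 0.
Proof.
move=> per fdf; have pi0 := pi_gt0 R.
have cf := is_derive1_continuous fdf.
have [t _ h] := @MVT R f df 0 (0 + pi + pi) ltac:(lra) (fun x _ => fdf x)
  (continuous_subspaceT cf).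
exists t; move: h; rewrite (per _ _ (rotation_period 0)) subrr => /esym/eqP.
by rewrite mulf_eq0 => /orP[/eqP//|/eqP]; lra.
Qed.

(** Going from [s] to [t] in the increasing direction takes at most one turn,
    along which an upper bound on the derivative suffices. *)
Lemma circular_oscillation (f df : R -> R) B : circular f ->
  (forall t, is_derive t 1 f (df t)) -> 0 <= B -> (forall t, df t <= B) ->
  forall s t, f t - f s <= B * (pi + pi).
Proof.
move=> per fdf B0 dfB s t; have pi0 := pi_gt0 R.
have cf := is_derive1_continuous fdf.
have growth x y : x <= y -> y - x <= pi + pi -> f y - f x <= B * (pi + pi).
  move=> xy yx.
  have [z _ ->] := MVT_segment xy (fun x _ => fdf x) (continuous_subspaceT cf).
  apply: (@le_trans _ _ (B * (y - x))); first by rewrite ler_wpM2r ?subr_ge0.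
  by rewrite ler_wpM2l.
have [s' + <-] := circular_reduce s per; rewrite in_itv /= => /andP[? ?].
have [t' + <-] := circular_reduce t per; rewrite in_itv /= => /andP[? ?].
have [st|ts] := leP s' t'; first by apply: growth; lra.
(* The arc from [s'] to [t'] runs once past the base point. *)
by rewrite -(per _ _ (rotation_period t')); apply: growth; lra.
Qed.

Lemma nonvanishing_sign (f : R -> R) : continuous f -> (forall t, f t <> 0) ->
  (forall t, f t < 0) \/ (forall t, 0 < f t).
Proof.
move=> cf f0.
have no_change (s t : R) : f s < 0 -> 0 < f t -> False.
  move=> fs ft; have [st|ts] := leP s t.
    have [|x _] := @IVT R f s t 0 st (continuous_subspaceT cf).
      by rewrite ge_min le_max (ltW fs) (ltW ft) ?orbT.
    exact: f0.
  have [|x _] := @IVT R f t s 0 (ltW ts) (continuous_subspaceT cf).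
    by rewrite ge_min le_max (ltW fs) (ltW ft) ?orbT.
  exact: f0.
have [neg|pos] := ltP (f 0) 0.
  left=> t; rewrite ltNge le_eqVlt; apply/negP => /orP[/eqP/esym/f0//|].
  exact: no_change neg.
right=> t; rewrite ltNge le_eqVlt; apply/negP => /orP[/eqP/f0//|ft].
apply: (no_change t 0 ft); rewrite lt_neqAle pos andbT eq_sym.
by apply/eqP; exact: f0.
Qed.

End Circular.

(** * Support functions *)

Section SupportFunction.
Context {R : realType}.
Implicit Types (p q s : R * R).

Definition support_function (A : set (R * R)) p : R := sup [set dot q p | q in A].

Variables (K : set (R * R)) (C : R).
Hypothesis bounded : forall q, K q -> `|q| <= C.
Hypothesis K0 : K 0.

Lemma dot_le_support q p : K q -> dot q p <= support_function K p.
Proof.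
move=> Kq; apply: ub_le_sup; last by exists q.
exists (2 * C * `|p|) => _ [w Kw <-].
apply: le_trans (ler_norm _) (le_trans (norm_dot_le _ _) _).
by rewrite ler_wpM2r// ler_wpM2l// bounded.
Qed.

Lemma support_le p x : (forall q, K q -> dot q p <= x) -> support_function K p <= x.
Proof.
move=> h; apply: ge_sup; first by exists (dot 0 p), 0.
by move=> _ [q Kq <-]; exact: h.
Qed.

(** Being a supremum of linear functions of slope at most [2 * C], the support
    function is Lipschitz. *)
Lemma support_function_continuous : continuous (support_function K).
Proof.
have lip p q : support_function K p - support_function K q <= 2 * C * `|p - q|.
  rewrite lerBlDr; apply: support_le => w Kw.
  rewrite -[p in dot w p](subrK q) dotC dotDl !(dotC _ w) lerD ?dot_le_support//.
  apply: le_trans (ler_norm _) (le_trans (norm_dot_le _ _) _).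
  by rewrite ler_wpM2r// ler_wpM2l// bounded.
have C0 : 0 <= C by apply: le_trans (bounded K0).
move=> p; apply/cvgrPdist_lt => e e0.
have d0 : 0 < e / (2 * C + 1) by rewrite divr_gt0//; lra.
near=> q.
have qp : `|p - q| < e / (2 * C + 1).
  by near: q; apply: (@cvgr_dist_lt _ _ _ _ _ id p _ _ d0); exact: cvg_id.
apply: (@le_lt_trans _ _ (2 * C * `|p - q|)).
  by rewrite ler_norml lip andbT lerNl opprB distrC lip.
apply: (@le_lt_trans _ _ ((2 * C + 1) * `|p - q|)).
  by rewrite ler_wpM2r//; lra.
by rewrite mulrC -ltr_pdivlMr//; lra.
Unshelve. all: by end_near.
Qed.

(** The support function of an intersection of half-planes is at most [b t] in
    the direction [m t], so its Wulff shape satisfies every inequality that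
    defines the intersection.  A Wulff shape only tests unit directions, whence
    the normalization of [m t]. *)
Lemma wulff_shape_support (T : Type) (m : T -> R * R) (b : T -> R) :
  (forall t, m t <> 0) -> K = [set q | forall t, dot q (m t) <= b t] ->
  wulff_shape (support_function K) = K.
Proof.
move=> m0 KE; apply/seteqP; split=> q; last first.
  by move=> Kq s _; exact: dot_le_support.
rewrite [X in _ -> X q]KE => Wq t.
pose l := Num.sqrt (dot (m t) (m t)).
have mm0 : 0 < dot (m t) (m t).
  rewrite lt_neqAle eq_sym; apply/andP; split; last by rewrite /dot; nra.
  by apply/eqP => /dot_eq0; exact: m0.
have l0 : 0 < l by rewrite sqrtr_gt0.
have ll : l * l = dot (m t) (m t) by rewrite -expr2 sqr_sqrtr// ltW.
have unit : unit_circle (l^-1 *: m t).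
  by apply/unit_circleE; rewrite dotZl dotZr -ll; field; rewrite gt_eqF.
have := Wq _ unit; rewrite /= => h.
have : support_function K (l^-1 *: m t) <= l^-1 * b t.
  apply: support_le => w; rewrite KE dotZr => /(_ t) /= wt.
  by rewrite ler_wpM2l// invr_ge0 ltW.
by move/(le_trans h); rewrite dotZr ler_pM2l// invr_gt0.
Qed.

End SupportFunction.

(** * Regular closed curves *)

Section ClosedCurve.
Context {R : realType}.
Variable c : R -> R * R.
Hypothesis per : circular c.
Hypothesis dc : forall t, derivable c t 1.
Implicit Types (p q v : R * R) (t a : R).
Notation c' := c^`()%classic.

Lemma closed_curve_critical q : exists t, dot q (c' t) = 0.
Proof.
apply: (@circular_critical R (fun t => dot q (c t)) (fun t => dot q (c' t))).
  exact: circular_dot.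
by move=> t; exact: is_derive_dot.
Qed.

(** Up to a factor, the signed distance from [p] to the line through [c t]
    directed by the velocity turned by [a - pi / 2].  Leaving [a] free lets one
    definition serve both sides, as adding [pi] to [a] reverses the sign. *)
Definition side_form a p t : R := dot (p - c t) (rotation a (c' t)).

Definition side a : set (R * R) := [set p | forall t, side_form a p t < 0].

Definition closed_side a : set (R * R) := [set p | forall t, side_form a p t <= 0].

Lemma side_form_circular a p : circular (side_form a p).
Proof.
by move=> s t st; rewrite /side_form (per st) (circular_derive1 per st).
Qed.

(** The difference of two points on opposite sides would have a negative scalar
    product with every turned velocity. *)
Lemma opposite_sides a p q : side a p -> ~ (forall t, 0 < side_form a q t).
Proof.
move=> ap aq.
have [t] := closed_curve_critical (rotation (- a) (p - q)).
rewrite -dot_rotation => h.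
have := ap t; have := aq t; move: h; rewrite /side_form !dotBl; lra.
Qed.

Lemma closure_side a : side a !=set0 -> closure (side a) = closed_side a.
Proof.
move=> [v sv]; apply/seteqP; split=> p.
  move=> clp t; rewrite leNgt; apply/negP => pos.
  have cont : {for p, continuous (fun q => side_form a q t)}.
    apply: cvg_dot; last exact: cvg_cst.
    by apply: cvgB; [exact: cvg_id|exact: cvg_cst].
  have [q [sq]] := clp _ (cont _ (lt_nbhsr pos)).
  by have := sq t => /= /lt_trans h /h; rewrite ltxx.
move=> hp B Bp.
(* The points of the open segment from [p] to [v] are strictly inside. *)
pose path x := x *: v + (1 - x) *: p.
have cpath : path @ 0^'+ --> p.
  have -> : p = path 0 by rewrite /path scale0r add0r subr0 scale1r.
  apply: cvg_at_right_filter.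
  apply: cvgD; first by apply: cvgZr_tmp; exact: cvg_id.
  by apply: cvgZr_tmp; apply: cvgB; [exact: cvg_cst|exact: cvg_id].
have nB : \forall x \near 0^'+, B (path x) by exact: cpath.
have : \forall x \near 0^'+, (B `&` side a) (path x).
  near=> x; split; first by near: x.
  move=> t.
  have x0 : 0 < x by near: x; exact: nbhs_right_gt.
  have x1 : x < 1 by near: x; exact: nbhs_right_lt.
  have := sv t; have := hp t.
  rewrite /side_form /path !dotBl dotDl !dotZl.
  by nra.
move=> /filter_ex[x [Bx sx]]; exists (path x); split => //.
Unshelve. all: by end_near.
Qed.

Hypothesis cc' : continuous c'.

Lemma closed_curve_continuous : continuous c.
Proof.
by move=> t; apply/differentiable_continuous/derivable1_diffP; exact: dc.
Qed.

Lemma normal_continuous a : continuous (fun t => rotation a (c' t)).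
Proof.
move=> t; apply: (@cvg_comp _ _ _ c' (rotation a) _ (nbhs (c' t))).
  exact: cc'.
exact: rotation_continuous.
Qed.

Lemma side_form_continuous a p : continuous (side_form a p).
Proof.
move=> t; apply: cvg_dot; last exact: normal_continuous.
by apply: cvgB; [exact: cvg_cst|exact: closed_curve_continuous].
Qed.

(** The lines bounding a side stay away from each of its points [v], so that a
    small step from [v] in any direction [s] stays inside.  The step is the
    minimum over the circle of the distance allowed by each line; adding [1] to
    the denominator keeps it nonzero and only shortens the step. *)
Lemma side_margin a v : side a v -> forall s, exists2 d : R,
  0 < d & side a (v + d *: s).
Proof.
move=> sv s; pose n t := dot s (rotation a (c' t)).
have sN t : 0 < - side_form a v t by rewrite oppr_gt0.
pose f t := - side_form a v t / (1 + `|n t|).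
have den t : 0 < 1 + `|n t| by rewrite ltr_pwDl.
have [||t0 ft0] := @circular_min R f.
- move=> t; apply: cvgM; first by apply: cvgN; exact: side_form_continuous.
  apply: cvgV; first by rewrite gt_eqF.
  apply: cvgD; first exact: cvg_cst.
  apply: cvg_norm; apply: cvg_dot; first exact: cvg_cst.
  exact: normal_continuous.
- move=> t u tu; rewrite /f /n (@side_form_circular a v _ _ tu).
  by rewrite (circular_derive1 per tu).
have f0 : 0 < f t0 by rewrite divr_gt0.
exists (f t0) => // t; have := ft0 t; rewrite [f t]/f ler_pdivlMr// => h.
have -> : side_form a (v + f t0 *: s) t = side_form a v t + f t0 * n t.
  by rewrite /side_form /n !dotBl dotDl dotZl; ring.
rewrite addrC -ltrBrDr sub0r; apply: lt_le_trans h.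
by rewrite (ltr_pM2l f0) (le_lt_trans (ler_norm _))// ltrDr.
Qed.

Hypothesis regular : forall t, c' t <> 0.

(** If [dot q (c t)] were constant, all velocities would be orthogonal to [q]; at
    a critical point of the functional given by a quarter turn of [q] the
    velocity would vanish. *)
Lemma regular_functional q : q <> 0 -> exists t, dot q (c t - c 0) <> 0.
Proof.
move=> q0; apply: contrapT => /forallNP const.
have {}const t : dot q (c t) = dot q (c 0).
  by apply/eqP; rewrite -subr_eq0 -dotBr; apply/eqP; exact: contrapT (const t).
have [t ct] := closed_curve_critical (rotation (pi / 2) q).
have ct0 : dot (c' t) q = 0.
  rewrite dotC; case: (is_derive_dot q (@dc t)) => _ <-.
  by rewrite (funext const) derive_cst.
apply: (regular (t := t)); rewrite dotC in ct.
by rewrite (orthogonal_multiple q0 ct) ct0 mul0r scale0r.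
Qed.

(** The scalar products of [q] with the chords of [c] are bounded by
    [circular_oscillation], and [regular_functional] gives two independent
    chords. *)
Lemma velocity_bounded B : exists C : R, forall q,
  (forall t, dot q (c' t) <= B) -> `|q| <= C.
Proof.
have [t1 d0] : exists t, dot (1, 0) (c t - c 0) <> 0.
  by apply: regular_functional => -[/eqP]; rewrite oner_eq0.
set d := c t1 - c 0 in d0.
have [t2 e0] : exists t, dot (- d.2, d.1) (c t - c 0) <> 0.
  apply: regular_functional => -[_ d10]; apply: d0.
  by rewrite /dot /= d10; ring.
set e := c t2 - c 0 in e0.
(* [B] may be negative, while [circular_oscillation] asks for a nonnegative
   bound. *)
have [|C hC] := @coordinates_bounded R d e (Num.max B 0 * (pi + pi)).
  by move: e0; rewrite /dot /= => e0 h; apply: e0; apply: etrans h; ring.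
exists C => q hq.
have osc s t : dot q (c t - c s) <= Num.max B 0 * (pi + pi).
  rewrite dotBr.
  apply: (@circular_oscillation R (fun t => dot q (c t)) (fun t => dot q (c' t))).
  - exact: circular_dot.
  - by move=> u; exact: is_derive_dot.
  - by rewrite le_max lexx orbT.
  - by move=> u; rewrite le_max hq.
by apply: hC; rewrite ler_norml osc andbT lerNl -mulN1r -dotZr scaleN1r opprB osc.
Qed.

(** On the closed side, scalar products with the normal at [t] are at most that
    of [c t], which is [- side_form a 0 t] and so is bounded over the circle. *)
Lemma closed_side_bounded a : exists C : R, forall p, closed_side a p -> `|p| <= C.
Proof.
have [||t0 max] := @circular_max R (fun t => - side_form a 0 t).
- by move=> t; apply: cvgN; exact: side_form_continuous.
- by move=> t u tu; rewrite (@side_form_circular a 0 _ _ tu).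
have [C hC] := velocity_bounded (- side_form a 0 t0).
exists (2 * C) => p hp.
rewrite -[p]rotation0 -(subrr a) rotationD.
apply: le_trans (rotation_norm_le _ _) _; rewrite ler_wpM2l//; apply: hC => t.
rewrite -dot_rotation; apply: le_trans (max t).
have := hp t; rewrite /side_form !dotBl.
have -> : dot 0 (rotation a (c' t)) = 0 by rewrite /dot /=; ring.
lra.
Qed.

(** A point [v] of the side is moved to the origin: the support function is then
    positive by [side_margin]. *)
Lemma closure_side_wulff a : side a !=set0 ->
  exists (v : R * R) (h : R * R -> R),
    [/\ {within unit_circle, continuous h},
        (forall s, unit_circle s -> 0 < h s) &
        translation v @` closure (side a) = wulff_shape h].
Proof.
move=> side_ne; have [v sv] := side_ne.
pose K := [set q | closed_side a (q + v)].
have K0 : K 0 by rewrite /K /= add0r => t; exact: ltW.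
have [C hC] := closed_side_bounded a.
have boundedK q : K q -> `|q| <= C + `|v|.
  by move=> /hC; rewrite -{2}[q](addrK v) => h; rewrite (le_trans (ler_normB _ _))// lerD2r.
exists (- v), (support_function K); split.
- exact/continuous_subspaceT/(support_function_continuous boundedK K0).
- move=> s /unit_circleE ss; have [d d0 sd] := side_margin sv s.
  have Kds : K (d *: s) by rewrite /K /= addrC => t; exact: ltW.
  apply: lt_le_trans d0 _.
  by have := dot_le_support boundedK s Kds; rewrite dotZl ss mulr1.
rewrite (wulff_shape_support boundedK K0 (m := fun t => rotation a (c' t))
  (b := fun t => - side_form a v t)).
- rewrite closure_side//; apply/seteqP; split=> q.
    by move=> [p hp <-]; rewrite /K /translation /= subrK.
  by move=> h; exists (q + v) => //; rewrite /translation addrK.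
- by move=> t /rotation_eq0; exact: regular.
apply/seteqP; split=> q h t; have := h t; rewrite /side_form !dotBl dotDl; lra.
Qed.

End ClosedCurve.

(** * Complements of turned tangent lines *)

Section NoSilhouette.
Context {R : realType}.
Variable r : R * R -> R * R.
Hypothesis r_immersion : circle_immersion r.
Implicit Types (theta t a : R) (p q s : R * R).
Let c : R -> R * R := circle_chart r (1, 0).
Notation c' := c^`()%classic.

Lemma unit_circle10 : unit_circle ((1, 0) : R * R).
Proof. by apply/unit_circleE; rewrite /dot /=; ring. Qed.

Lemma circular_circle_chart : circular c.
Proof. by move=> s t st; rewrite /c /circle_chart st. Qed.

Lemma circle_chart_derivable t : derivable c t 1.
Proof. exact: (r_immersion.1 _ unit_circle10 0%N t). Qed.

Lemma circle_chart_derive_continuous : continuous c'.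
Proof.
move=> t; apply/differentiable_continuous/derivable1_diffP.
exact: (r_immersion.1 _ unit_circle10 1%N t).
Qed.

Lemma derive1_circle_chart t :
  (circle_chart r (rotation t (1, 0)))^`()%classic 0 = c' t.
Proof.
rewrite /derive1; congr (lim (_ @ 0^')); apply/funext => h.
by rewrite /c /circle_chart -!rotationD addr0 add0r.
Qed.

Lemma circle_chart_regular t : c' t <> 0.
Proof.
move=> ct0; have unit_t := rotation_unit_circle t.
set s := rotation t (1, 0) in unit_t.
suff /rotation_eq0 s0 : rotation (pi / 2) s = 0.
  move: unit_t => /unit_circleE; rewrite s0 /dot /= => /esym/eqP.
  by rewrite mul0r addr0 oner_eq0.
apply: (r_immersion.2 _ unit_t).
  exact: dot_quarter_turn.
by rewrite /circle_diff derive1_circle_chart ct0 scaler0.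
Qed.

Lemma rotated_tangent_lineE theta t p :
  rotated_tangent_line theta r (rotation t (1, 0)) p <->
  side_form c (theta + pi / 2) p t = 0.
Proof.
rewrite /side_form.
have turn q : rotation (theta + pi / 2) q = rotation (pi / 2) (rotation theta q).
  by rewrite addrC rotationD.
rewrite turn; split.
  move=> [_ [v _ <-] <-]; rewrite /circle_diff derive1_circle_chart rotationZ.
  rewrite addrAC subrr add0r dotZl dot_quarter_turn.
  exact: mulr0.
move=> /orthogonal_multiple E.
have /E {}E : rotation theta (c' t) <> 0.
  by move/rotation_eq0; exact: circle_chart_regular.
set k := _ / _ in E; set s := rotation t (1, 0).
have unit : dot s s = 1 by apply/unit_circleE; exact: rotation_unit_circle.
exists (k *: c' t); last by rewrite rotationZ -E addrC subrK.
exists (k *: rotation (pi / 2) s).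
  by rewrite /circle_tangent /= dotZr dot_quarter_turn mulr0.
by rewrite /circle_diff derive1_circle_chart dotZl dot_rotation2 unit mulr1.
Qed.

(** The turned tangent lines avoid [p] exactly when [p] is on one strict side of
    all of them, and by [opposite_sides] only one of the two sides is inhabited. *)
Lemma NS_side theta : exists a, NS theta r = side c a.
Proof.
have opp p t : side_form c (theta - pi / 2) p t = - side_form c (theta + pi / 2) p t.
  by rewrite /side_form rotationB_pi2 dotNr.
have sides p : NS theta r p <->
    side c (theta + pi / 2) p \/ side c (theta - pi / 2) p.
  split=> [NSp|pside].
    have [||neg|pos] := @nonvanishing_sign R (side_form c (theta + pi / 2) p).
    - apply: side_form_continuous; first exact: circle_chart_derivable.
      exact: circle_chart_derive_continuous.
    - move=> t ?; apply: NSp; exists (rotation t (1, 0)); first exact: rotation_unit_circle.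
      exact/rotated_tangent_lineE.
    - by left.
    - by right=> t; rewrite opp oppr_lt0.
  move=> [s unit_s]; have [t _ ->] := unit_circle_rotation unit_s.
  move=> /rotated_tangent_lineE E.
  by case: pside => /(_ t); rewrite ?opp E ?oppr0 ltxx.
have [[q qside]|empty] := pselect (side c (theta + pi / 2) !=set0).
  exists (theta + pi / 2); apply/seteqP; split=> p; last by move=> ?; apply/sides; left.
  move=> /sides[//|pside]; exfalso.
  apply: (opposite_sides circular_circle_chart circle_chart_derivable qside (q := p)).
  by move=> t; have := pside t; rewrite opp oppr_lt0.
exists (theta - pi / 2); apply/seteqP; split=> p; last by move=> ?; apply/sides; right.
by move=> /sides[pside|//]; exfalso; apply: empty; exists p.
Qed.

End NoSilhouette.

Theorem proposition6 (R : realType) (r : R * R -> R * R)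
    (r_immersion : circle_immersion r)
    (r_no_silhouette : no_silhouette r !=set0)
    (theta : R) (theta_range : 0 <= theta < aperture_angle r) :
  exists (v : R * R) (h : R * R -> R),
    [/\ {within unit_circle, continuous h},
        (forall s, unit_circle s -> 0 < h s) &
        translation v @` closure (NS theta r) = wulff_shape h].
Proof.
have /andP[theta0 theta_lt] := theta_range.
(* The supremum of the empty set is [0], so [theta_range] excludes it. *)
have candidates : aperture_candidates r !=set0.
  apply: contrapT => /set0P/negP; rewrite negbK => /eqP empty.
  by move: theta_lt; rewrite /aperture_angle empty sup0 ltNge theta0.
have [[_ /(_ _ theta_range) NSne] _] := aperture_angle_max candidates.
have [a NSE] := NS_side r_immersion theta.
rewrite NSE in NSne *; apply: closure_side_wulff NSne.
- exact: circular_circle_chart.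
- exact: circle_chart_derivable.
- exact: circle_chart_derive_continuous.
- exact: circle_chart_regular.
Qed.
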